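(* Let $N(t)$, $t\ge0$, be a homogeneous Poisson process of rate $\lambda>0$. For every $t>0$, every integer $n\ge0$ and every integer $k\ge1$, $$\mathbb E\left\{\int_0^t [N(s)]^k\,\mathrm ds\,\Bigg|\,N(t)=n\right\}=\frac{t}{n+1}\sum_{j=1}^n j^k .$$
   Context: An empty sum (case $n=0$) is equal to zero. *)

(* Defs.v *)
From mathcomp Require Import all_boot all_order all_algebra.
From mathcomp Require Import all_classical all_reals all_analysis.

Set Implicit Arguments.
Unset Strict Implicit.
Unset Printing Implicit Defensive.

Import Order.TTheory GRing.Theory Num.Theory.
Import numFieldNormedType.Exports.

Local Open Scope classical_set_scope.
Local Open Scope ring_scope.

Section Probability.
Context (d : measure_display) (T : measurableType d) (R : realType)
  (P : probability T R).

(* The product rule over subfamilies of I is the special case A i = setT for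
   the remaining indices i. *)
Definition mutually_independent (d' : measure_display)
    (T' : measurableType d') (I : finType) (X : I -> T -> T') : Prop :=
  forall A : I -> set T', (forall i, measurable (A i)) ->
    P (\bigcap_i (X i @^-1` A i)) = (\prod_i P (X i @^-1` A i))%E.

(* E[X | A] for an event A; meaningful only when P A > 0. *)
Definition cond_expectation (X : T -> R) (A : set T) : \bar R :=
  ('E_P[X \* \1_A] / P A)%E.

End Probability.

Section PoissonProcess.
Context (d : measure_display) (T : measurableType d) (R : realType)
  (P : probability T R).

(* The difference is truncated, but the processes below are nondecreasing. *)
Definition increment (N : R -> {RV P >-> nat}) (s t : R) : T -> nat :=
  fun w => (N t w - N s w)%N.

(* The index set is [0, +oo[: the values of N at negative times are
   unconstrained and irrelevant. *)
Record counting_process (N : R -> {RV P >-> nat}) : Prop := {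
  counting_process0 : forall w, N 0 w = 0%N;
  counting_process_nondecreasing : forall w (s t : R),
    0 <= s -> s <= t -> (N s w <= N t w)%N;
  counting_process_right_continuous : forall w (t : R), 0 <= t ->
    (N s w)%:R @[s --> t^'+] --> ((N t w)%:R : R) }.

Record poisson_process (rate : R) (N : R -> {RV P >-> nat}) : Prop := {
  poisson_process_counting : counting_process N;
  poisson_process_independent : forall (t : nat -> R) (m : nat),
    0 <= t 0%N -> nondecreasing_seq t ->
    mutually_independent P (fun i : 'I_m => increment N (t i) (t i.+1));
  poisson_process_law : forall (s t : R) (n : nat), 0 <= s -> s < t ->
    P [set w | increment N s t w = n] =
    (poisson_pmf (rate * (t - s)) n)%:E }.

End PoissonProcess.

(* Main.v *)
Require Import Defs.
From mathcomp Require Import all_boot all_order all_algebra.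
From mathcomp Require Import all_classical all_reals all_analysis.
From mathcomp Require Import measurable_realfun ring.

(** The integral of [N(s) ^ k] over [0, t] depends on a path only through its
    occupation times, the Lebesgue measures of the sets of times at which the
    path sits at each level [j]: it is the sum over [j] of [j ^ k] times the
    occupation time of [j] ([integral_occupation]).  The result follows from the
    fact that, given [N(t) = n], the levels [0], ..., [n] all have the same
    expected occupation time [t / (n + 1)] ([expected_occupation]).

    For this fact, Tonelli's theorem rewrites the expected occupation time of
    [j] as the integral over [s] of the probability that [N(s) = j], given
    [N(t) = n].  Independence of increments and the Poisson law make this
    probability the binomial weight [C(n, j) (s / t)^j (1 - s / t)^(n - j)]
    ([poisson_joint_law]), a Bernstein polynomial in [s / t].  The integral of
    this polynomial over [0, t] is [t / (n + 1)] for every [j], by an explicit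
    telescoping antiderivative ([integral_bernstein]).

    Tonelli's theorem needs the process to be measurable jointly in time and
    outcome; this comes from the right-continuity and monotonicity of the paths
    ([measurable_sublevel]). *)

Set Implicit Arguments.
Unset Strict Implicit.
Unset Printing Implicit Defensive.

Import Order.TTheory GRing.Theory Num.Theory.
Import numFieldNormedType.Exports.

Local Open Scope classical_set_scope.
Local Open Scope ring_scope.

(** * Integrals of Bernstein polynomials *)

Lemma integral_deriv_poly (R : realType) (p : {poly R}) (a b : R) : a < b ->
  (\int[lebesgue_measure]_(x in `[a, b]) (p^`().[x])%:E = (p.[b] - p.[a])%:E)%E.
Proof.
move=> ab; rewrite EFinB.
apply: (@continuous_FTC2 R (horner p^`()) (horner p)) => //.
- by apply: continuous_in_subspaceT => x _; exact: continuous_horner.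
- split=> [x _||]; first exact: derivable_horner.
  + by apply: cvg_at_right_filter; exact: continuous_horner.
  + by apply: cvg_at_left_filter; exact: continuous_horner.
- by move=> x _; rewrite derivE.
Qed.

(** The ring is arbitrary because [u] is a polynomial where derivatives are
    taken and a number where probabilities are computed. *)
Definition bernstein (R : comNzRingType) (n j : nat) (u : R) : R :=
  'C(n, j)%:R * (u ^+ j * (1 - u) ^+ (n - j)).

(** The difference on the right makes the sum of the derivatives over
    consecutive indices telescope, which yields an antiderivative of each
    Bernstein polynomial. *)
Lemma deriv_bernsteinS (R : comNzRingType) (n j : nat) (u : {poly R}) :
  (j <= n)%N ->
  (bernstein n.+1 j.+1 u)^`() =
  n.+1%:R * u^`() * (bernstein n j u - bernstein n j.+1 u).
Proof.
move=> jn; rewrite /bernstein mulr_natl derivMn derivM !deriv_exp derivB derivC.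
rewrite subSS sub0r /= -subnS.
have E1 : 'C(n.+1, j.+1)%:R * j.+1%:R = n.+1%:R * 'C(n, j)%:R :> {poly R}.
  by rewrite -!natrM mulnC -mul_bin_diag.
have E2 : 'C(n.+1, j.+1)%:R * (n - j)%:R = n.+1%:R * 'C(n, j.+1)%:R :> {poly R}.
  by rewrite -!natrM mulnC -[(n - j)%N]subSS -mul_bin_down.
move: (u ^+ j) (u ^+ j.+1) ((1 - u) ^+ (n - j)) ((1 - u) ^+ (n - j.+1)) (u^`()).
move=> x y z w v.
rewrite -(mulr_natr (v * x)) -(mulr_natr (- v * w)) -(mulr_natl (_ + _)).
have alg (a b c C0 C1 C2 x' y' z' w' v' : {poly R}) :
    C0 * a = b * C1 -> C0 * c = b * C2 ->
    C0 * (v' * x' * a * z' + y' * (- v' * w' * c)) =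
    b * v' * (C1 * (x' * z') - C2 * (y' * w')).
  move=> e1 e2.
  transitivity (v' * x' * z' * (C0 * a) - v' * y' * w' * (C0 * c)).
    by ring.
  by rewrite e1 e2; ring.
exact: alg.
Qed.

(** An antiderivative of the integrand is [t / (n + 1)] times the sum of the
    Bernstein polynomials of degree [n + 1] and index greater than [j].  At [0]
    all these terms vanish, and at [t] only the one of index [n + 1] survives,
    with value [1]; hence a result that does not depend on [j]. *)
Lemma integral_bernstein (R : realType) (t : R) (n j : nat) :
  0 < t -> (j <= n)%N ->
  (\int[lebesgue_measure]_(s in `[0%R, t]) (bernstein n j (s / t))%:E =
   (t / n.+1%:R)%:E)%E.
Proof.
move=> t0 jn; have tn0 : t != 0 by rewrite gt_eqF.
pose u : {poly R} := t^-1 *: 'X.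
have uE s : u.[s] = s / t by rewrite /u !hornerE mulrC.
have bE m i s : (bernstein m i u).[s] = bernstein m i (s / t).
  rewrite /bernstein -polyC_natr !hornerM !horner_exp.
  by rewrite hornerD hornerN !hornerC uE.
pose Q : {poly R} :=
  (t / n.+1%:R) *: \sum_(j <= i < n.+1) bernstein n.+1 i.+1 u.
have dQ : Q^`() = bernstein n j u.
  have du : u^`() = t^-1%:P by rewrite /u derivZ derivX alg_polyC.
  rewrite /Q derivZ raddf_sum /=.
  have dB i : (j <= i < n.+1)%N -> (bernstein n.+1 i.+1 u)^`() =
      n.+1%:R * u^`() * (bernstein n i u - bernstein n i.+1 u).
    by case/andP=> _ i_le; exact: deriv_bernsteinS.
  rewrite (eq_big_nat _ _ dB).
  rewrite -mulr_sumr (telescope_sumr_eq (fun i => - bernstein n i u));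
    last 2 first.
  - exact: leqW.
  - by move=> i _; rewrite opprK addrC.
  (* The upper end of the telescoping sum has index n + 1 > n. *)
  rewrite opprK [X in - X]/bernstein bin_small// mul0r oppr0 add0r.
  rewrite du -polyC_natr -polyCM mul_polyC scalerA.
  by rewrite mulrA divfK ?pnatr_eq0// divff// scale1r.
under eq_integral do rewrite -bE -dQ.
rewrite integral_deriv_poly//; congr EFin.
rewrite /Q !hornerZ !horner_sum.
rewrite [X in _ - _ * X]big1 ?mulr0 ?subr0; last first.
  by move=> i _; rewrite bE mul0r /bernstein exprS !mul0r mulr0.
rewrite big_nat_recr//= big1_seq ?add0r; last first.
  move=> i; rewrite mem_index_iota => /andP[_ /andP[_ ilt]].
  rewrite bE divff// /bernstein subrr subSS expr0n subn_eq0 leqNgt ilt.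
  by rewrite !mulr0.
by rewrite bE divff// /bernstein binn subnn expr1n !mulr1.
Qed.

Section PoissonOccupation.
Context (R : realType) (d : measure_display) (T : measurableType d)
  (P : probability T R).
Implicit Type N : R -> {RV P >-> nat}.

(** * Joint law and joint measurability of the process *)

Lemma measurable_RV_preimage (X : {RV P >-> nat}) (B : set nat) :
  measurable (X @^-1` B).
Proof. by rewrite -[X in measurable X]setTI; apply: measurable_funPT. Qed.

(** The exponentials multiply to [expR (- (l * t))] and the factorials recombine
    into a binomial coefficient: given [n] points in [0, t], the number of them
    in [0, s] is binomial with parameters [n] and [s / t]. *)
Lemma poisson_pmf_split (l s t : R) (n j : nat) :
  0 < l -> 0 < s -> s < t -> (j <= n)%N ->
  poisson_pmf (l * s) j * poisson_pmf (l * (t - s)) (n - j) =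
  poisson_pmf (l * t) n * bernstein n j (s / t).
Proof.
move=> l0 s0 st jn; have t0 : 0 < t by exact: lt_trans st.
rewrite /poisson_pmf !mulr_gt0 ?subr_gt0// /bernstein.
have -> : 1 - s / t = (t - s) / t by field; rewrite gt_eqF.
have -> : - (l * t) = - (l * s) + - (l * (t - s)) by ring.
rewrite expRD.
have -> : (l * t) ^+ n = (l * t) ^+ j * (l * t) ^+ (n - j).
  by rewrite -exprD subnKC.
have -> : 'C(n, j)%:R = n`!%:R / (j`!%:R * (n - j)`!%:R) :> R.
  apply: (canRL (mulfK _)).
    by rewrite -natrM pnatr_eq0 -lt0n muln_gt0 !fact_gt0.
  by rewrite -!natrM bin_fact.
rewrite !exprMn !exprVn; field.
by rewrite !expf_neq0 ?gt_eqF// !pnatr_eq0 -!lt0n !fact_gt0.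
Qed.

(** As the paths start at [0] and are nondecreasing, the event says that the
    independent increments over [0, s] and [s, t] are [j] and [n - j]. *)
Lemma poisson_joint_law N (l s t : R) (n j : nat) : poisson_process l N ->
  0 < l -> 0 < s -> s < t -> (j <= n)%N ->
  P [set w | N s w = j /\ N t w = n] =
  (poisson_pmf (l * t) n * bernstein n j (s / t))%:E.
Proof.
move=> [[N0 Nnd _] indep law] l0 s0 st jn.
(* The independence axiom takes an infinite sequence of times; the partition
   0 < s < t is extended by the constant t. *)
pose time i : R := if i is i'.+1 then if i' is _.+1 then t else s else 0.
pose A (i : 'I_2) := [set if val i == 0%N then j else (n - j)%N].
have nd : nondecreasing_seq time.
  by apply/nondecreasing_seqP => -[|[|i]] //=; exact: ltW.
have /(_ A (fun _ => I)) := indep time 2 (lexx _) nd.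
rewrite big_ord_recl big_ord_recl big_ord0 mule1 /=.
have law_s := law 0 s j (lexx _) s0.
have law_st := law s t (n - j)%N (ltW s0) st.
rewrite subr0 in law_s.
rewrite -poisson_pmf_split// EFinM -law_s -law_st => <-.
congr (P _); apply/seteqP; split => w /=.
- move=> [Ns Nt] i _; case: i => -[|[|//]] i2; rewrite /A /increment /=.
  + by rewrite N0 subn0.
  + by rewrite Ns Nt.
- move=> Aw; have := Aw ord0 I; have := Aw (lift ord0 ord0) I.
  rewrite /A /increment /= N0 subn0 => Nst Ns; split=> //.
  by rewrite -(subnK (Nnd w s t (ltW s0) (ltW st))) Nst Ns subnK.
Qed.

(** A right-continuous integer-valued path that is at most [j] at [s] is still
    at most [j] at some rational time after [s]; conversely, by monotonicity,
    being at most [j] at a later time forces it at [s].  So the set is a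
    countable union of measurable rectangles, one for each rational time. *)
Lemma measurable_sublevel N (j : nat) : counting_process N ->
  measurable [set sw : R * T | 0 <= sw.1 /\ (N sw.1 sw.2 <= j)%N].
Proof.
move=> [_ Nnd Nrc].
have -> : [set sw : R * T | 0 <= sw.1 /\ (N sw.1 sw.2 <= j)%N] =
    \bigcup_q (`[0, ratr q[ `*` [set w | (N (ratr q) w <= j)%N]).
  apply/seteqP; split => -[s w] /=.
  - move=> [s0 Nsj].
    have := Nrc w s s0; move/cvgrPdist_lt => /(_ 1 ltr01).
    move=> [e /= e0 near_s].
    have [q] : exists q, ratr q \in `]s, s + e[.
      by apply: rat_in_itvoo; rewrite ltrDl.
    rewrite in_itv/= => /andP[sq qse]; exists q => //=; split.
      by rewrite in_itv/= s0.
    have q_near : ball_ Num.norm s e (ratr q).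
      by rewrite /= distrC ger0_norm ?subr_ge0 1?ltW// ltrBlDl.
    move: (near_s _ q_near sq); rewrite distrC -natrB ?Nnd ?(ltW sq)//.
    rewrite ger0_norm// (ltr_nat _ _ 1) ltnS leqn0 subn_eq0 => Nqs.
    exact: leq_trans Nqs Nsj.
  - move=> [q _ [/=]]; rewrite in_itv/= => /andP[s0 sq] Nqj; split=> //.
    by apply: leq_trans Nqj; apply: Nnd => //; exact: ltW.
apply: bigcupT_measurable_rat => q; apply: measurableX.
  exact: measurable_itv.
exact: (measurable_RV_preimage _ [set m | (m <= j)%N]).
Qed.

(** * Occupation times *)

Definition occupation N (t : R) (j : nat) (w : T) : set R :=
  `[0, t] `&` [set s | N s w = j].

(** Indexed by time and outcome together, so that Tonelli's theorem can exchange
    the integral over time with the expectation. *)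
Definition occupation_graph N (t : R) (n j : nat) : set (R * T) :=
  [set sw | [/\ occupation N t j sw.2 sw.1 & N t sw.2 = n]].

Lemma measurable_occupation_graph N (t : R) (n j : nat) : counting_process N ->
  measurable (occupation_graph N t n j).
Proof.
move=> cN.
have -> : occupation_graph N t n j =
    (`[0, t] `*` [set w | N t w = n]) `&`
    ([set sw : R * T | 0 <= sw.1 /\ (N sw.1 sw.2 <= j)%N] `\`
     \bigcup_(i < j) [set sw : R * T | 0 <= sw.1 /\ (N sw.1 sw.2 <= i)%N]).
  apply/seteqP; split => -[s w] /=.
  - move=> [[/= st Nsj] Ntn]; split=> //; split.
      by rewrite Nsj; move: st; rewrite in_itv/= => /andP[].
    by move=> [i /= ij [_]]; rewrite Nsj leqNgt ij.
  - move=> [[/= st Ntn] [[s0 Nsj] notlt]]; split=> //; split=> //=.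
    apply/eqP; rewrite eqn_leq Nsj leqNgt; apply/negP => Nltj.
    by apply: notlt; exists (N s w).
apply: measurableI.
  by apply: measurableX => //; exact: (measurable_RV_preimage (N t) [set n]).
apply: measurableD; first exact: measurable_sublevel.
by apply: bigcup_measurable => i _; exact: measurable_sublevel.
Qed.

Lemma ysection_occupation_graph N (t : R) (n j : nat) (w : T) :
  ysection (occupation_graph N t n j) w =
  if N t w == n then occupation N t j w else set0.
Proof.
apply/seteqP; split=> s; rewrite ysectionE /occupation_graph /=.
  by move=> [sj ->]; rewrite eqxx.
by case: eqP.
Qed.

Lemma integral_occupation_graph N (t : R) (n j : nat) :
  (\int[P]_w lebesgue_measure (ysection (occupation_graph N t n j) w) =
   \int[P]_(w in [set w | N t w = n]) lebesgue_measure (occupation N t j w))%E.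
Proof.
rewrite [RHS]integral_mkcond; apply: eq_integral => w _.
rewrite ysection_occupation_graph patchE.
by case: eqP => Nt; [rewrite mem_set|rewrite memNset// measure0].
Qed.

Lemma measurable_fun_occupation N (t : R) (n j : nat) : counting_process N ->
  measurable_fun [set w | N t w = n]
    (fun w => lebesgue_measure (occupation N t j w)).
Proof.
move=> cN; apply: (@eq_measurable_fun _ _ _ _ _
    (fun w => lebesgue_measure (ysection (occupation_graph N t n j) w))).
  by move=> w /[!inE] /= Nt; rewrite ysection_occupation_graph Nt eqxx.
apply: measurable_funTS.
by apply: measurable_fun_ysection; exact: measurable_occupation_graph.
Qed.

(** By Tonelli the left-hand side is the integral over [s] of the probability
    that the path is at [j] at time [s] and at [n] at time [t].  This is the
    probability of being at [n] at time [t] times a Bernstein polynomial in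
    [s / t], whose integral is the same for all [j]. *)
Lemma expected_occupation N (l t : R) (n j : nat) : poisson_process l N ->
  0 < l -> 0 < t -> (j <= n)%N ->
  (\int[P]_(w in [set w | N t w = n]) lebesgue_measure (occupation N t j w) =
   (t / n.+1%:R * poisson_pmf (l * t) n)%:E)%E.
Proof.
move=> NP l0 t0 jn; have cN := poisson_process_counting NP.
have mG := measurable_occupation_graph t n j cN.
rewrite -integral_occupation_graph.
have := @indic_fubini_tonelli _ _ _ _ R lebesgue_measure P _ mG.
rewrite indic_fubini_tonelli_FE// indic_fubini_tonelli_GE// => <-.
transitivity (\int[lebesgue_measure]_(s in `[0%R, t])
    P (xsection (occupation_graph N t n j) s))%E.
  rewrite [RHS]integral_mkcond; apply: eq_integral => s _ /=.
  rewrite patchE; case: ifPn => // /negP s_out.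
  rewrite (_ : xsection _ _ = set0) ?measure0//.
  rewrite -subset0 => w; rewrite xsectionE /= => -[[st _] _].
  by apply: s_out; rewrite inE.
(* The joint law is known for 0 < s < t, which loses only the two endpoints. *)
rewrite integral_itv_bndoo; last first.
  by apply: measurable_funTS; exact: measurable_fun_xsection.
under eq_integral => s.
  rewrite inE /= in_itv /= => /andP[s0 st].
  rewrite (_ : xsection _ _ = [set w | N s w = j /\ N t w = n]); last first.
    apply/seteqP; split=> w; rewrite xsectionE /=; first by move=> [[]].
    by move=> [? ?]; split=> //; split=> //=; rewrite in_itv/= !ltW.
  rewrite (poisson_joint_law NP)// EFinM.
  over.
have mb : measurable_fun [set: R] (fun s : R => bernstein n j (s / t)).
  rewrite /bernstein.
  apply: measurable_funM => //.
  by apply: measurable_funM; apply: measurable_funX;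
    [|apply: measurable_funB => //]; apply: measurable_funM.
rewrite -(@integral_itv_bndoo _ _ _ _ true false); last first.
  apply: measurable_funTS; apply: measurable_funeM; exact/measurable_EFinP.
rewrite ge0_integralZl//=.
- by rewrite integral_bernstein// -EFinM mulrC.
- by apply: measurable_funTS; exact/measurable_EFinP.
- move=> s; rewrite in_itv/= => /andP[s0 st]; rewrite lee_fin /bernstein.
  by rewrite !mulr_ge0 ?exprn_ge0 ?divr_ge0 ?subr_ge0 ?ler_pdivrMr ?mul1r// ltW.
- by rewrite lee_fin poisson_pmf_ge0.
Qed.

(** A nondecreasing path ending at [n] takes on [0, t] only the values [0], ...,
    [n], so that its composition with [f] is a step function. *)
Lemma integral_occupation N (f : nat -> R) (t : R) (n : nat) (w : T) :
  counting_process N -> (forall j, 0 <= f j) -> N t w = n ->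
  ((\int[lebesgue_measure]_(s in `[0, t]) f (N s w))%:E =
   \sum_(0 <= j < n.+1) (f j)%:E * lebesgue_measure (occupation N t j w))%E.
Proof.
move=> cN f0 Ntw.
have mO j : measurable (occupation N t j w).
  have := measurable_ysection w (measurable_occupation_graph t n j cN).
  by rewrite ysection_occupation_graph Ntw eqxx.
have int : (\int[lebesgue_measure]_(s in `[0%R, t]) (f (N s w))%:E =
    \sum_(0 <= j < n.+1) (f j)%:E * lebesgue_measure (occupation N t j w))%E.
  transitivity (\int[lebesgue_measure]_(s in `[0%R, t])
      \sum_(0 <= j < n.+1) ((f j)%:E * (\1_(occupation N t j w) s)%:E))%E.
    apply: eq_integral => s /[!inE] /= st.
    have [s0 st'] : 0 <= s /\ s <= t by move: st; rewrite in_itv/= => /andP.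
    rewrite (bigD1_seq (N s w)) ?iota_uniq//=; last first.
      rewrite mem_index_iota ltnS -Ntw.
      by apply: (counting_process_nondecreasing cN).
    rewrite indicE mem_set// mule1 big1 ?adde0// => j jNs.
    rewrite indicE memNset ?mule0// => -[_ /= Nsj].
    by rewrite Nsj eqxx in jNs.
  rewrite ge0_integral_sum//.
  - apply: eq_bigr => j _; rewrite ge0_integralZl ?lee_fin//.
    + rewrite integral_indic; [|exact: measurable_itv|exact: mO].
      by rewrite setIidl // => s [].
    + by apply/measurable_EFinP/measurable_indic; exact: mO.
  - move=> j; apply/measurable_funeM/measurable_EFinP/measurable_indic.
    exact: mO.
  - by move=> j s _; rewrite mule_ge0 ?lee_fin.
rewrite /Rintegral int fineK//.
apply/sum_fin_numP => j _ _; rewrite fin_numM//.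
rewrite ge0_fin_numE//; apply: (@le_lt_trans _ _ (lebesgue_measure `[0, t])).
  apply: le_measure; last by move=> s [].
  - by rewrite inE; exact: mO.
  - by rewrite inE; exact: measurable_itv.
by rewrite lebesgue_measure_itv/=; case: ifP => _; rewrite ?ltry.
Qed.

End PoissonOccupation.

(** * Conditional expectation *)

Theorem theorem4p2 (R : realType) (d : measure_display) (T : measurableType d)
    (P : probability T R) (lambda : R) (N : R -> {RV P >-> nat})
    (lambda_gt0 : 0 < lambda) (NP : poisson_process lambda N)
    (t : R) (t_gt0 : 0 < t) (n k : nat) (k_ge1 : (1 <= k)%N) :
  cond_expectation P
    (fun w => \int[lebesgue_measure]_(s in `[0, t]) ((N s w)%:R ^+ k))
    [set w | N t w = n] =
  (t / n.+1%:R * \sum_(1 <= j < n.+1) j%:R ^+ k)%:E.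
Proof.
have cN := poisson_process_counting NP.
set A := [set w | N t w = n]; pose f j : R := j%:R ^+ k.
have f0 j : 0 <= f j by exact: exprn_ge0.
pose p := poisson_pmf (lambda * t) n.
have PA : P A = p%:E.
  have := poisson_process_law NP n (lexx 0) t_gt0.
  rewrite subr0 => <-; congr (P _); apply/seteqP.
  by split=> w; rewrite /A /increment /= (counting_process0 cN) subn0.
have p0 : p != 0.
  rewrite gt_eqF// /p /poisson_pmf mulr_gt0//.
  by rewrite !mulr_gt0 ?exprn_gt0 ?expR_gt0 ?mulr_gt0// invr_gt0 ltr0n fact_gt0.
rewrite /cond_expectation unlock PA.
transitivity ((\int[P]_(w in A) \sum_(0 <= j < n.+1)
    (f j)%:E * lebesgue_measure (occupation N t j w)) / p%:E)%E.
  congr (_ / _)%E; rewrite [RHS]integral_mkcond; apply: eq_integral => w _.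
  rewrite patchE /= indicE; case: ifPn => [/[!inE] Ntw|_];
    last by rewrite mulr0.
  by rewrite mulr1 -(integral_occupation cN f0 Ntw).
have mA : measurable A by exact: (measurable_RV_preimage (N t) [set n]).
rewrite ge0_integral_sum//; last 2 first.
- by move=> j; apply: measurable_funeM; exact: measurable_fun_occupation.
- by move=> j w _; rewrite mule_ge0// lee_fin.
under eq_big_nat => j /andP[_ j_le].
  rewrite ge0_integralZl ?lee_fin//; last exact: measurable_fun_occupation.
  rewrite (expected_occupation NP)// -EFinM.
  over.
rewrite sumEFin inver (negbTE p0) -EFinM; congr EFin.
rewrite -mulr_suml mulrA mulfK//.
(* The sum starts at index 0, whose term vanishes because k >= 1. *)
rewrite mulrC big_ltn//=.
by rewrite /f expr0n gtn_eqF// add0r.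
Qed.
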